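(* Every tree-cograph $G$ is b-monotonic; that is, $\chi_b(H_1) \geq \chi_b(H_2)$ for every induced subgraph $H_1$ of $G$ and every induced subgraph $H_2$ of $H_1$.
   Context: Graphs are finite and simple. For vertex-disjoint graphs $G_1=(V_1,E_1)$ and $G_2=(V_2,E_2)$, the union is $G_1\cup G_2=(V_1\cup V_2,E_1\cup E_2)$, and the join $G_1\vee G_2$ is obtained from the union by adding all edges between $V_1$ and $V_2$. A co-tree is a graph whose complement is a tree. Tree-cographs are defined recursively: a graph $G$ is a tree-cograph if and only if (i) $G$ is a tree or a co-tree, or (ii) $G$ is the union of two tree-cographs, or (iii) $G$ is the join of two tree-cographs. A b-coloring of a graph with $t$ colors is a proper coloring of the vertices with $t$ colors such that every color class contains a vertex that is adjacent to all other $t-1$ color classes. The b-chromatic number $\chi_b(G)$ is the maximum $t$ such that $G$ admits a b-coloring with $t$ colors. *)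

(* Defs.v *)
From mathcomp Require Import all_boot.

Set Implicit Arguments.
Unset Strict Implicit.
Unset Printing Implicit Defensive.

Record sgraph := SGraph {
  vertex :> finType;
  adj : rel vertex;
  adj_sym : symmetric adj;
  adj_irr : irreflexive adj
}.

Definition isomorphic (G H : sgraph) : Prop :=
  exists f : G -> H,
    bijective f /\ forall x y : G, adj (f x) (f y) = adj x y.

Section Induced.
Variables (G : sgraph) (A : {set G}).

Definition induced_adj : rel {x : G | x \in A} :=
  fun u v => adj (val u) (val v).

Lemma induced_adj_sym : symmetric induced_adj.
Proof. by move=> u v; rewrite /induced_adj adj_sym. Qed.

Lemma induced_adj_irr : irreflexive induced_adj.
Proof. by move=> u; rewrite /induced_adj adj_irr. Qed.

Definition induced : sgraph := SGraph induced_adj_sym induced_adj_irr.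
End Induced.

Section Complement.
Variable G : sgraph.

Definition compl_adj : rel G := fun x y => (x != y) && ~~ adj x y.

Lemma compl_adj_sym : symmetric compl_adj.
Proof. by move=> x y; rewrite /compl_adj eq_sym adj_sym. Qed.

Lemma compl_adj_irr : irreflexive compl_adj.
Proof. by move=> x; rewrite /compl_adj eqxx. Qed.

Definition compl : sgraph := SGraph compl_adj_sym compl_adj_irr.
End Complement.

(* The sum type makes the two vertex sets disjoint. *)
Section UnionJoin.
Variables G1 G2 : sgraph.

Definition union_adj : rel (G1 + G2) := fun u v =>
  match u, v with
  | inl x, inl y => adj x y
  | inr x, inr y => adj x y
  | _, _ => false
  end.

Definition join_adj : rel (G1 + G2) := fun u v =>
  match u, v with
  | inl x, inl y => adj x y
  | inr x, inr y => adj x y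
  | _, _ => true
  end.

Lemma union_adj_sym : symmetric union_adj.
Proof. by move=> [x|x] [y|y] //=; rewrite adj_sym. Qed.

Lemma union_adj_irr : irreflexive union_adj.
Proof. by move=> [x|x] /=; rewrite adj_irr. Qed.

Lemma join_adj_sym : symmetric join_adj.
Proof. by move=> [x|x] [y|y] //=; rewrite adj_sym. Qed.

Lemma join_adj_irr : irreflexive join_adj.
Proof. by move=> [x|x] /=; rewrite adj_irr. Qed.

Definition graph_union : sgraph := SGraph union_adj_sym union_adj_irr.
Definition graph_join : sgraph := SGraph join_adj_sym join_adj_irr.
End UnionJoin.

Definition connected (G : sgraph) : Prop :=
  forall x y : G, connect (@adj G) x y.

(* [ucycle] also accepts [:: x; y] for an edge xy, which is not a cycle of
   the graph; hence the bound 2. *)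
Definition acyclic (G : sgraph) : Prop :=
  forall c : seq G, ucycle (@adj G) c -> size c <= 2.

Definition tree (G : sgraph) : Prop :=
  [/\ 0 < #|G|, connected G & acyclic G].

Definition cotree (G : sgraph) : Prop := tree (compl G).

Inductive tree_cograph : sgraph -> Prop :=
| TC_tree G : tree G -> tree_cograph G
| TC_cotree G : cotree G -> tree_cograph G
| TC_union G G1 G2 : tree_cograph G1 -> tree_cograph G2 ->
    isomorphic G (graph_union G1 G2) -> tree_cograph G
| TC_join G G1 G2 : tree_cograph G1 -> tree_cograph G2 ->
    isomorphic G (graph_join G1 G2) -> tree_cograph G.

Definition proper_coloring (G : sgraph) (t : nat) (c : {ffun G -> 'I_t}) : bool :=
  [forall x, forall y, adj x y ==> (c x != c y)].

Definition b_coloring (G : sgraph) (t : nat) (c : {ffun G -> 'I_t}) : bool :=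
  proper_coloring c &&
  [forall i, exists x, (c x == i) &&
    [forall j, (j != i) ==> [exists y, adj x y && (c y == j)]]].

Definition b_colorable (G : sgraph) (t : nat) : bool :=
  [exists c : {ffun G -> 'I_t}, b_coloring c].

(* The color classes of a b-coloring are nonempty, so the range t <= #|G|
   loses nothing; see chi_bP. *)
Definition chi_b (G : sgraph) : nat :=
  \max_(t < #|G|.+1 | b_colorable G t) t.

Lemma b_colorable_le_card (G : sgraph) (t : nat) :
  b_colorable G t -> t <= #|G|.
Proof.
case/existsP=> c /andP[_ /forallP cb].
have csurj i : exists x, c x == i.
  by have /existsP[x /andP[cx _]] := cb i; exists x.
pose f i := xchoose (csurj i).
have fK : cancel f c by move=> i; apply/eqP; apply: (xchooseP (csurj i)).
by rewrite -[t]card_ord; apply: (leq_card f); apply: can_inj fK.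
Qed.

Lemma b_colorable_ex (G : sgraph) : exists t, b_colorable G t.
Proof.
have ex0 : exists t, [exists c : {ffun G -> 'I_t}, proper_coloring c].
  exists #|G|; apply/existsP; exists [ffun x => enum_rank x].
  apply/forallP=> x; apply/forallP=> y; apply/implyP=> xy.
  rewrite !ffunE; apply: contraL xy => /eqP/enum_rank_inj ->.
  by rewrite adj_irr.
case: (ex_minnP ex0) => t /existsP[c cP] tmin; exists t.
apply/existsP; exists c; rewrite /b_coloring cP /=.
apply: contraT; rewrite negb_forall => /existsP[i /existsPn nb].
have miss x : c x == i ->
    exists j, (j != i) && [forall y, adj x y ==> (c y != j)].
  move=> cx; have := nb x; rewrite cx /= negb_forall => /existsP[j].
  rewrite negb_imply => /andP[ji /existsPn ny]; exists j; rewrite ji /=.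
  by apply/forallP=> y; have := ny y; rewrite negb_and -implybE.
have ex_d x : exists j, if c x == i
    then (j != i) && [forall y, adj x y ==> (c y != j)] else j == c x.
  by case cx: (c x == i); [apply: miss | exists (c x)].
pose d x := xchoose (ex_d x).
have dP x : if c x == i
    then (d x != i) && [forall y, adj x y ==> (c y != d x)] else d x == c x.
  exact: (xchooseP (ex_d x)).
have di x : d x != i.
  by have := dP x; case: ifP => [_ /andP[]//|/negbT cx /eqP->].
have dproper x y : adj x y -> d x != d y.
  move=> xy; have := forallP (forallP cP x) y; rewrite xy /= => cxy.
  have := dP x; have := dP y; case: ifP => cy; case: ifP => cx.
  - by move: cxy; rewrite (eqP cx) (eqP cy) eqxx.
  - case/andP=> _ /forallP/(_ x); rewrite adj_sym xy /= => H /eqP->; exact: H.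
  - move=> /eqP-> /andP[_ /forallP/(_ y)]; by rewrite xy eq_sym.
  - by move=> /eqP-> /eqP->.
clearbody d; clear ex_d dP.
case: t i d di dproper tmin {c cP nb miss} => [[]//|t] i d di dproper tmin.
have ld x : {j | d x = lift i j}.
  have ne : i != d x by rewrite eq_sym.
  by have [j ? _] := unlift_some ne; exists j.
have /tmin : [exists c' : {ffun G -> 'I_t}, proper_coloring c'].
  apply/existsP; exists [ffun x => sval (ld x)].
  apply/forallP=> x; apply/forallP=> y; apply/implyP=> /dproper.
  rewrite !ffunE; apply: contraNneq => e.
  by rewrite (svalP (ld x)) e -(svalP (ld y)).
by rewrite ltnn.
Qed.

Lemma chi_bP (G : sgraph) :
  b_colorable G (chi_b G) /\ forall t, b_colorable G t -> t <= chi_b G.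
Proof.
have le_chi t : b_colorable G t -> t <= chi_b G.
  move=> Gt; have lt_t : t < #|G|.+1 by rewrite ltnS b_colorable_le_card.
  by rewrite /chi_b (bigD1 (Ordinal lt_t)) //= leq_maxl.
split=> //; have [t Gt] := b_colorable_ex G.
have lt_t : t < #|G|.+1 by rewrite ltnS b_colorable_le_card.
rewrite /chi_b (bigop.bigmax_eq_arg (Ordinal lt_t)) //.
by case: arg_maxnP.
Qed.

Definition b_monotonic (G : sgraph) : Prop :=
  forall (A : {set G}) (B : {set induced A}),
    chi_b (induced B) <= chi_b (induced A).

(* Main.v *)
(** Call a colour dominated if some vertex of that colour sees all other colours.
A graph is "dom-monotone" if, whenever B is a subset of A and A is colourable from
the palette S, every S-colouring of B can be traded for an S-colouring of A with
at least the same dominated colours. This gives b-monotonicity: a b-coloring of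
the smaller graph with t colours has all t colours dominated, and if the larger
graph is not t-colourable its b-chromatic number exceeds t anyway.

Dom-monotonicity passes to unions, and to joins by splitting the palette: if the
part of the palette used on one side of the join is too small for the larger
graph, enlarge it to a minimal sufficient one, all of whose colours are
automatically dominated, and delete the borrowed colours on the other side.

For trees and co-trees one adds a single vertex v. In a forest, v takes some
colour c, and c is swapped with another colour in the component of each neighbour
coloured c; v itself then dominates c. In a co-tree the colour classes are the
edges of a matching and single vertices of a bipartite graph F. If an alternating
path of F leads from v to an unmatched vertex, augment. Otherwise the vertices
reachable from v, with their mates, split off, and the remaining vertices are
recoloured by induction with one colour fewer. *)

Require Import Defs.
From mathcomp Require Import all_boot perm.

(** * Colorings and dominated colours *)

Section Colorings.
Variable G : sgraph.
Implicit Types A B : {set G}.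

(** The vertex set [A] and the palette [S] are parameters and [f] is total on [G], so vertices and
    colours can be added or removed without changing any type; only the values of [f] on [A]
    matter. *)
Definition coloring {C : finType} A (S : {set C}) (f : G -> C) :=
  [forall x in A, f x \in S] &&
  [forall x in A, forall y in A, adj x y ==> (f x != f y)].

Definition dominating {C : finType} A (S : {set C}) (f : G -> C) x :=
  (x \in A) && [forall j in S, (j != f x) ==>
                 [exists y in A, adj x y && (f y == j)]].

Definition dominated {C : finType} A (S : {set C}) (f : G -> C) c :=
  [exists x, dominating A S f x && (f x == c)].

Lemma coloringP (C : finType) A (S : {set C}) (f : G -> C) :
  reflect ({in A, forall x, f x \in S} /\
           {in A &, forall x y, adj x y -> f x != f y})
          (coloring A S f).
Proof.
apply: (iffP andP) => -[fS fP]; split.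
- by move=> x xA; have /forall_inP/(_ x xA) := fS.
- by move=> x y xA yA; move/forall_inP/(_ x xA)/forall_inP/(_ y yA)/implyP: fP.
- by apply/forall_inP=> x; apply: fS.
- by apply/forall_inP=> x xA; apply/forall_inP=> y yA; apply/implyP; apply: fP.
Qed.

Lemma dominatingP (C : finType) A (S : {set C}) (f : G -> C) x :
  reflect (x \in A /\ forall j, j \in S -> j != f x ->
             exists y, [/\ y \in A, adj x y & f y = j])
          (dominating A S f x).
Proof.
apply: (iffP andP) => -[xA H]; split=> //.
  move=> j jS jx; have /exists_inP[y yA /andP[xy /eqP fy]] :=
    implyP (forall_inP H j jS) jx.
  by exists y.
apply/forall_inP=> j jS; apply/implyP=> jx; have [y [yA xy fy]] := H j jS jx.
by apply/exists_inP; exists y => //; rewrite xy fy /=.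
Qed.

Lemma dominatedP (C : finType) A (S : {set C}) (f : G -> C) c :
  reflect (exists2 x, dominating A S f x & f x = c) (dominated A S f c).
Proof.
apply: (iffP existsP) => [[x /andP[xD /eqP fx]]|[x xD fx]]; exists x => //.
by rewrite xD fx /=.
Qed.

Lemma dominated_onto (C : finType) A (S : {set C}) (f : G -> C) c :
  dominated A S f c -> S \subset f @: A.
Proof.
case/dominatedP=> x /dominatingP[xA xD] fx; apply/subsetP=> j jS.
have [->|jx] := eqVneq j (f x); first exact: imset_f.
by have [y [yA _ <-]] := xD j jS jx; apply: imset_f.
Qed.

Lemma coloring_sub (C : finType) A B (S : {set C}) (f : G -> C) :
  B \subset A -> coloring A S f -> coloring B S f.
Proof.
move=> /subsetP BA /coloringP[fS fP]; apply/coloringP; split.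
  by move=> x /BA; apply: fS.
by move=> x y /BA xA /BA yA; apply: fP.
Qed.

Lemma coloring_filter (C : finType) A (S T : {set C}) (f : G -> C) :
  coloring A S f -> coloring [set x in A | f x \in T] T f.
Proof.
move=> /coloringP[_ fP]; apply/coloringP; split=> [x|x y].
  by rewrite inE => /andP[].
by rewrite !inE => /andP[xA _] /andP[yA _]; apply: fP.
Qed.

Lemma dominated_filter (C : finType) A (S T : {set C}) (f : G -> C) c :
  T \subset S -> c \in T -> dominated A S f c ->
  dominated [set x in A | f x \in T] T f c.
Proof.
move=> /subsetP TS cT /dominatedP[x /dominatingP[xA xD] fx].
apply/dominatedP; exists x => //; apply/dominatingP; split.
  by rewrite inE xA fx.
move=> j jT jx; have [y [yA xy fy]] := xD j (TS j jT) jx.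
by exists y; rewrite inE yA fy jT.
Qed.

Lemma coloring_card (C : finType) A (S S' : {set C}) (f : G -> C) :
  coloring A S f -> #|S| <= #|S'| -> exists g, coloring A S' g.
Proof.
move=> /coloringP[fS fP] le_SS'.
pose r c := nth c (enum S') (index c (enum S)).
have rlt c : c \in S -> index c (enum S) < size (enum S').
  move=> cS; apply: leq_trans (_ : _ < size (enum S)) _.
    by rewrite index_mem mem_enum.
  by rewrite -!cardE.
exists (r \o f); apply/coloringP; split=> [x /fS xS|x y xA yA /(fP x y xA yA)].
  by rewrite /= /r -mem_enum mem_nth ?rlt.
apply: contraNneq => /=; have [xS yS] := (fS x xA, fS y yA).
rewrite /r (set_nth_default (f y)) ?rlt // => /eqP.
rewrite nth_uniq ?rlt ?enum_uniq // => /eqP/(congr1 (nth (f x) (enum S))).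
by rewrite !nth_index ?mem_enum // => ->.
Qed.

(** If [c] were not dominated, every vertex coloured [c] would miss another colour of [S] and could
    move to it. These vertices are pairwise non-adjacent, so all can move at once, which frees
    [c]. *)
Lemma minimal_dominated (C : finType) A (S : {set C}) (h : G -> C) c :
  coloring A S h -> c \in S ->
  (forall g : G -> C, ~~ coloring A (S :\ c) g) -> dominated A S h c.
Proof.
move=> /coloringP[hS hP] cS Smin; apply: contraT => /dominatedP nD.
pose free x j := [&& j \in S, j != c & [forall y in A, adj x y ==> (h y != j)]].
have freeP x : x \in A -> h x = c -> exists j, free x j.
  move=> xA hx; apply/existsP; apply: contraT => /existsPn nf; case: nD.
  exists x => //; apply/dominatingP; split=> // j jS; rewrite hx => jc.
  have := nf j; rewrite /free jS jc /= => /forall_inPn[y yA].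
  by rewrite negb_imply negbK => /andP[xy /eqP]; exists y.
pose g x := if h x == c then odflt c [pick j | free x j] else h x.
have gE x : x \in A -> if h x == c then free x (g x) else g x == h x.
  move=> xA; rewrite /g; case: eqP => // hx.
  by case: pickP => //= nf; have [j] := freeP x xA hx; rewrite nf.
suff : coloring A (S :\ c) g by rewrite (negbTE (Smin g)).
apply/coloringP; split=> [x xA|x y xA yA xy].
  have := gE x xA; rewrite !inE; case: ifP => [_ /and3P[-> ->]//|hx /eqP->].
  by rewrite hx hS.
have := gE x xA; have := gE y yA; have := hP x y xA yA xy.
case: ifP => hy; case: ifP => hx; first by rewrite (eqP hx) (eqP hy) eqxx.
- move=> _ /and3P[_ _ /forall_inP/(_ x xA)].
  by rewrite adj_sym xy /= => ? /eqP->.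
- move=> _ /eqP-> /and3P[_ _ /forall_inP/(_ y yA)].
  by rewrite xy eq_sym.
- by move=> ? /eqP-> /eqP->.
Qed.

Lemma onto_coloring (C : finType) A (S : {set C}) (f : G -> C) :
  coloring A S f -> #|S| <= #|A| ->
  exists g, [/\ coloring A S g, S \subset g @: A
    & subpred (dominated A S f) (dominated A S g)].
Proof.
move=> fA le_SA; have [n] := ubnP #|S :\: f @: A|.
elim: n f fA => // n IHn f fA; rewrite ltnS => le_n.
have [onto|nonto] := boolP (S \subset f @: A); first by exists f; split.
have nD c : dominated A S f c = false.
  by apply: contraNF nonto; apply: dominated_onto.
have [j jS jf] := subsetPn nonto.
have [fS fP] := coloringP _ _ _ _ fA.
have /dinjectivePn[x xA [y /andP[/= yx yA] fxy]] : ~~ dinjectiveb f (mem A).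
  apply: contraL le_SA => /dinjectiveP/card_in_imset <-.
  rewrite -ltnNge; apply: proper_card; rewrite properE nonto andbT.
  by apply/subsetP=> _ /imsetP[x xA ->]; apply: fS.
pose g z := if z == x then j else f z.
have gj z : z \in A -> z != x -> j != f z.
  by move=> zA _; apply: contraNneq jf => ->; apply: imset_f.
have gA : coloring A S g.
  apply/coloringP; split=> [z zA|z w zA wA zw]; rewrite /g.
    by case: ifP => // _; apply: fS.
  case: (eqVneq z x) => zx; case: (eqVneq w x) => wx; last exact: fP.
  - by rewrite zx wx adj_irr in zw.
  - exact: gj.
  - by rewrite eq_sym gj.
have [|g' [g'A g'S _]] := IHn g gA; last first.
  by exists g'; split=> // c; rewrite nD.
apply: leq_trans le_n; apply: proper_card; apply/properP; split.
  apply: setDS; apply/subsetP=> _ /imsetP[z zA ->].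
  have [->|zx] := eqVneq z x; last first.
    by apply/imsetP; exists z => //; rewrite /g (negbTE zx).
  by apply/imsetP; exists y => //; rewrite /g (negbTE yx).
exists j; rewrite !inE jS ?jf //= andbT negbK.
by apply/imsetP; exists x => //; rewrite /g eqxx.
Qed.
End Colorings.

(** * Unions and joins *)

(* The palette can be permuted, so asking that the dominated colours of f stay
   dominated is no stronger than asking that their number does not decrease. *)
Definition dom_monotone_at (G : sgraph) (C : finType) (A : {set G}) :=
  forall (B : {set G}) (S : {set C}) (f h : G -> C),
  B \subset A -> coloring G A S h -> coloring G B S f ->
  exists2 g, coloring G A S g
    & subpred (dominated G B S f) (dominated G A S g).

Definition dom_monotone (G : sgraph) :=
  forall (C : finType) (A : {set G}), dom_monotone_at G C A.

(** Deleting from [B] the vertices coloured outside [T] keeps the dominated colours of [T]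
    dominated. Since [f] uses all of [S], there are at least [#|T|] vertices, so the new colouring
    can be made onto [T]. In a join the other side needs to see all these colours. *)
Lemma dom_monotone_onto (G : sgraph) (C : finType) (A B : {set G})
    (S T : {set C}) (f h : G -> C) :
  dom_monotone_at G C A -> B \subset A -> T \subset S -> S \subset f @: B ->
  coloring G B S f -> coloring G A T h ->
  exists g, [/\ coloring G A T g, T \subset g @: A
    & {in T, forall c, dominated G B S f c -> dominated G A T g c}].
Proof.
move=> mG BA TS Sf fB hA; pose B' := [set x in B | f x \in T].
have B'A : B' \subset A.
  by apply: subset_trans BA; apply/subsetP=> x; rewrite inE => /andP[].
have [g gA gD] := mG B' T f h B'A hA (coloring_filter _ _ _ S T f fB).
have [|g' [g'A g'T g'D]] := onto_coloring G C A T g gA.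
  apply: leq_trans (subset_leq_card B'A).
  apply: leq_trans (leq_imset_card f (mem B')); apply: subset_leq_card.
  apply/subsetP=> c cT.
  have /imsetP[x xB cE] := subsetP Sf c (subsetP TS c cT).
  by rewrite cE imset_f // inE xB -cE cT.
exists g'; split=> // c cT fc; apply/g'D/gD.
exact: (dominated_filter G C B S T f c TS cT fc).
Qed.

(** Both sides use the same palette and no edge runs between them, so domination is decided within
    one side and the sides are recoloured independently. *)
Lemma union_dom_monotone (G1 G2 : sgraph) :
  dom_monotone G1 -> dom_monotone G2 -> dom_monotone (graph_union G1 G2).
Proof.
move=> m1 m2 C A B S f h BA hA fB.
pose L (X : {set G1 + G2}) : {set G1} := [set x | inl x \in X].
pose R (X : {set G1 + G2}) : {set G2} := [set x | inr x \in X].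
have colL X k : coloring (graph_union G1 G2) X S k ->
    coloring G1 (L X) S (k \o inl).
  move=> /coloringP[kS kP]; apply/coloringP; split=> [x|x y]; rewrite !inE.
    exact: kS.
  exact: (kP (inl x) (inl y)).
have colR X k : coloring (graph_union G1 G2) X S k ->
    coloring G2 (R X) S (k \o inr).
  move=> /coloringP[kS kP]; apply/coloringP; split=> [x|x y]; rewrite !inE.
    exact: kS.
  exact: (kP (inr x) (inr y)).
have LBA : L B \subset L A.
  by apply/subsetP=> x; rewrite !inE; apply: (subsetP BA).
have RBA : R B \subset R A.
  by apply/subsetP=> x; rewrite !inE; apply: (subsetP BA).
have [g1 /coloringP[g1S g1P] g1D] := m1 C _ _ S _ _ LBA (colL A h hA) (colL B f fB).
have [g2 /coloringP[g2S g2P] g2D] := m2 C _ _ S _ _ RBA (colR A h hA) (colR B f fB).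
exists (fun z => match z with inl x => g1 x | inr y => g2 y end).
  apply/coloringP; split=> [[x|x] xA|[x|x] [y|y] xA yA //= xy].
  - by apply: g1S; rewrite inE.
  - by apply: g2S; rewrite inE.
  - by apply: g1P => //; rewrite inE.
  - by apply: g2P => //; rewrite inE.
move=> c /dominatedP[[x|x] /dominatingP[xB xD] fx].
  have /g1D/dominatedP[x' /dominatingP[x'A x'D] gx'] :
      dominated G1 (L B) S (f \o inl) c.
    apply/dominatedP; exists x => //; apply/dominatingP; split; first by rewrite inE.
    by move=> j jS jx; have [[y|y] [yB xy fy]] := xD j jS jx => //; exists y; rewrite inE.
  apply/dominatedP; exists (inl x') => //; apply/dominatingP; rewrite inE in x'A.
  split=> // j jS jx; have [y [yA xy gy]] := x'D j jS jx.
  by exists (inl y); split=> //; rewrite inE in yA.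
have /g2D/dominatedP[x' /dominatingP[x'A x'D] gx'] :
    dominated G2 (R B) S (f \o inr) c.
  apply/dominatedP; exists x => //; apply/dominatingP; split; first by rewrite inE.
  by move=> j jS jx; have [[y|y] [yB xy fy]] := xD j jS jx => //; exists y; rewrite inE.
apply/dominatedP; exists (inr x') => //; apply/dominatingP; rewrite inE in x'A.
split=> // j jS jx; have [y [yA xy gy]] := x'D j jS jx.
by exists (inr y); split=> //; rewrite inE in yA.
Qed.

Lemma iso_dom_monotone (G H : sgraph) :
  isomorphic G H -> dom_monotone H -> dom_monotone G.
Proof.
move=> [p [[q pK qK] pP]] mH C A B S f h BA hA fB.
have qP x y : adj (q x) (q y) = adj x y by rewrite -pP !qK.
have colq X k : coloring G X S k -> coloring H (q @^-1: X) S (k \o q).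
  move=> /coloringP[kS kP]; apply/coloringP; split=> [x|x y]; rewrite !inE.
    exact: kS.
  by rewrite -qP; apply: kP.
have [|g /coloringP[gS gP] gD] :=
  mH C (q @^-1: A) (q @^-1: B) S _ _ _ (colq A h hA) (colq B f fB).
  exact: preimsetS.
exists (g \o p).
  apply/coloringP; split=> [x xA|x y xA yA xy] /=.
    by apply: gS; rewrite inE pK.
  by apply: gP; rewrite ?inE ?pK ?pP.
move=> c /dominatedP[x /dominatingP[xB xD] fx].
have /gD/dominatedP[z /dominatingP[zA zD] gz] :
    dominated H (q @^-1: B) S (f \o q) c.
  apply/dominatedP; exists (p x); rewrite /= ?pK //; apply/dominatingP.
  rewrite inE /= pK; split=> // j jS jx; have [y [yB xy fy]] := xD j jS jx.
  by exists (p y); rewrite inE /= pK pP.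
apply/dominatedP; exists (q z); rewrite /= ?qK //; apply/dominatingP.
rewrite inE in zA; rewrite /= qK; split=> // j jS jx.
have [y [yA zy gy]] := zD j jS jx.
by exists (q y); rewrite inE in yA; rewrite /= qK qP.
Qed.

(** [U] is inclusion-minimal among the sufficient palettes between [T] and [S]. As [T] does not
    suffice, removing some colour of [U] outside [T] leaves an insufficient palette. Sufficiency
    depends only on size, so no smaller palette suffices; this bounds [#|U|] and makes every colour
    of [U] dominated. *)
Lemma minimal_palette (G : sgraph) (C : finType) (A : {set G})
    (S T H : {set C}) (h : G -> C) :
  T \subset S -> coloring G A H h -> #|H| <= #|S| ->
  (forall g : G -> C, ~~ coloring G A T g) ->
  exists (U : {set C}) (g : G -> C),
    [/\ T \subset U, U \subset S, #|U| <= #|H|, coloring G A U g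
      & {in U, forall c, dominated G A U g c}].
Proof.
move=> TS hA HS nT.
pose P (U : {set C}) := (T \subset U) && [exists g : {ffun G -> C}, coloring G A U g].
have PP (U : {set C}) (g : G -> C) : T \subset U -> coloring G A U g -> P U.
  move=> TU /coloringP[gU gP]; rewrite /P TU; apply/existsP; exists (finfun g).
  apply/coloringP; split=> [x xA|x y xA yA xy]; rewrite !ffunE; first exact: gU.
  exact: gP.
have [k kA] := coloring_card G C A H S h hA HS.
have [U Umin US] := @minset_exists _ P S (PP S k TS kA).
have /andP[TU /existsP[g gA]] := minsetp Umin.
have /subsetPn[i iU iT] : ~~ (U \subset T).
  apply/negP=> UT; have := nT g; have -> : T = U by apply/eqP; rewrite eqEsubset TU.
  by rewrite gA.
have nUi (g' : G -> C) : ~~ coloring G A (U :\ i) g'.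
  apply/negP=> g'A; have /(PP _ g')/(_ g'A) : T \subset U :\ i.
    by rewrite subsetD1 TU iT.
  by move/(minsetinf Umin)/(_ (subD1set U i))/setP/(_ i); rewrite !inE iU eqxx.
exists U, g; split=> //.
  rewrite leqNgt; apply/negP=> HU.
  have [|g' g'A] := coloring_card G C A H (U :\ i) h hA.
    by move: HU; rewrite (cardsD1 i U) iU.
  by have := nUi g'; rewrite g'A.
move=> c cU; apply: minimal_dominated => // g'; apply/negP=> g'A.
have [|g'' g''A] := coloring_card G C A (U :\ c) (U :\ i) g' g'A.
  by have := cardsD1 i U; rewrite (cardsD1 c U) iU cU => /addnI->.
by have := nUi g''; rewrite g''A.
Qed.

(** The first side takes a minimal palette [U] of at most [#|H1|] colours, which leaves at least
    [#|H2|] for the second. The second side only loses colours, because [S :\: U] lies in [T2]. *)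
Lemma split_palette (G1 G2 : sgraph) (C : finType)
    (A1 : {set G1}) (A2 B2 : {set G2}) (S T1 T2 H1 H2 : {set C})
    (h1 : G1 -> C) (f2 h2 : G2 -> C) :
  dom_monotone G2 -> B2 \subset A2 ->
  coloring G1 A1 H1 h1 -> coloring G2 A2 H2 h2 -> #|H1| + #|H2| <= #|S| ->
  coloring G2 B2 T2 f2 -> T2 \subset f2 @: B2 ->
  T1 \subset S -> S :\: T1 \subset T2 ->
  (forall g : G1 -> C, ~~ coloring G1 A1 T1 g) ->
  exists (U : {set C}) (g1 : G1 -> C) (g2 : G2 -> C), [/\ T1 \subset U, U \subset S,
    coloring G1 A1 U g1 /\ {in U, forall c, dominated G1 A1 U g1 c},
    coloring G2 A2 (S :\: U) g2 /\ S :\: U \subset g2 @: A2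
    & {in S :\: U, forall c, dominated G2 B2 T2 f2 c ->
                             dominated G2 A2 (S :\: U) g2 c}].
Proof.
move=> m2 BA hA1 hA2 HS fB2 onto2 T1S ST2 nT1.
have [U [g1 [TU US leU g1A g1D]]] := minimal_palette G1 C A1 S T1 H1 h1 T1S hA1
  (leq_trans (leq_addr _ _) HS) nT1.
have [|k kA] := coloring_card G2 C A2 H2 (S :\: U) h2 hA2.
  rewrite cardsD (setIidPr US) -(leq_add2l #|H1|) (leq_trans HS) //.
  by rewrite addnBA ?subset_leq_card //
    leq_subRL ?leq_add2r // (leq_trans (subset_leq_card US)) ?leq_addl.
have UT2 : S :\: U \subset T2 by apply: subset_trans ST2; apply: setDS.
have [g2 [g2A g2S g2D]] :=
  dom_monotone_onto G2 C A2 B2 T2 (S :\: U) f2 k (m2 C A2) BA UT2 onto2 fB2 kA.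
by exists U, g1, g2.
Qed.

Lemma join_dom_monotone (G1 G2 : sgraph) :
  dom_monotone G1 -> dom_monotone G2 -> dom_monotone (graph_join G1 G2).
Proof.
move=> m1 m2 C A B S f h BA hA fB.
(* Without a dominated colour [h] itself serves. Otherwise [f] uses all of [S], so the palettes of
   the two sides partition [S]. *)
have [/existsP[c0 /dominated_onto Sf]|] :=
    boolP [exists c, dominated (graph_join G1 G2) B S f c]; last first.
  by move=> /existsPn nD; exists h => // c; rewrite /= (negbTE (nD c)).
have [fS fP] := coloringP _ _ _ _ _ fB.
have [hS hP] := coloringP _ _ _ _ _ hA.
pose A1 : {set G1} := [set x | inl x \in A].
pose B1 : {set G1} := [set x | inl x \in B].
pose A2 : {set G2} := [set x | inr x \in A].
pose B2 : {set G2} := [set x | inr x \in B].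
have BA1 : B1 \subset A1 by apply/subsetP=> x; rewrite !inE; apply: (subsetP BA).
have BA2 : B2 \subset A2 by apply/subsetP=> x; rewrite !inE; apply: (subsetP BA).
pose f1 x := f (inl x); pose f2 x := f (inr x).
pose h1 x := h (inl x); pose h2 x := h (inr x).
pose T1 := f1 @: B1; pose T2 := f2 @: B2.
have f1B : coloring G1 B1 T1 f1.
  apply/coloringP; split=> [x xB|x y]; first exact: imset_f.
  by rewrite !inE; apply: (fP (inl x) (inl y)).
have f2B : coloring G2 B2 T2 f2.
  apply/coloringP; split=> [x xB|x y]; first exact: imset_f.
  by rewrite !inE; apply: (fP (inr x) (inr y)).
have h1A : coloring G1 A1 (h1 @: A1) h1.
  apply/coloringP; split=> [x xB|x y]; first exact: imset_f.
  by rewrite !inE; apply: (hP (inl x) (inl y)).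
have h2A : coloring G2 A2 (h2 @: A2) h2.
  apply/coloringP; split=> [x xB|x y]; first exact: imset_f.
  by rewrite !inE; apply: (hP (inr x) (inr y)).
have cardH : #|h1 @: A1| + #|h2 @: A2| <= #|S|.
  have h12 : h1 @: A1 :&: h2 @: A2 = set0.
    apply/setP=> c; rewrite !inE; apply/negP=> /andP[/imsetP[x xA ->] /imsetP[y yA]].
    rewrite !inE in xA yA => e.
    by have /eqP[] : h (inl x) != h (inr y) by apply: hP.
  rewrite -cardsUI h12 cards0 addn0; apply/subset_leq_card/subsetP=> c.
  by rewrite inE => /orP[] /imsetP[x xA ->]; rewrite inE in xA; apply: hS.
have T12 c : c \in T1 -> c \in T2 -> False.
  move=> /imsetP[x xA ->] /imsetP[y yA] e; rewrite !inE in xA yA.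
  by have /eqP[] : f (inl x) != f (inr y) by apply: fP.
have T1S : T1 \subset S.
  by apply/subsetP=> _ /imsetP[x xB ->]; rewrite inE in xB; apply: fS.
have T2S : T2 \subset S.
  by apply/subsetP=> _ /imsetP[x xB ->]; rewrite inE in xB; apply: fS.
have ST2 : S :\: T1 \subset T2.
  apply/subsetP=> c; rewrite inE => /andP[cT1 /(subsetP Sf)/imsetP[[x|x] xB cE]].
    by case/negP: cT1; rewrite cE; apply: imset_f; rewrite inE.
  by rewrite cE; apply: imset_f; rewrite inE.
have ST1 : S :\: T2 \subset T1.
  apply/subsetP=> c; rewrite inE => /andP[cT2 /(subsetP Sf)/imsetP[[x|x] xB cE]].
    by rewrite cE; apply: imset_f; rewrite inE.
  by case/negP: cT2; rewrite cE; apply: imset_f; rewrite inE.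
have fD c : dominated (graph_join G1 G2) B S f c ->
    dominated G1 B1 T1 f1 c \/ dominated G2 B2 T2 f2 c.
  move=> /dominatedP[[x|x] /dominatingP[xB xD] fx]; [left|right].
    apply/dominatedP; exists x => //; apply/dominatingP; split; first by rewrite inE.
    move=> j jT jx; have [[y|y] [yB xy fy]] := xD j (subsetP T1S j jT) jx.
      by exists y; rewrite inE.
    by case: (T12 j jT); rewrite -fy; apply: imset_f; rewrite inE.
  apply/dominatedP; exists x => //; apply/dominatingP; split; first by rewrite inE.
  move=> j jT jx; have [[y|y] [yB xy fy]] := xD j (subsetP T2S j jT) jx.
    by case: (T12 j) => //; rewrite -fy; apply: imset_f; rewrite inE.
  by exists y; rewrite inE.
(* Onto colourings of the sides with complementary palettes combine, as each vertex sees every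
   colour of the opposite side. The disjunctions allow a dominated colour to change sides. *)
suff [U1 [U2 [g1 [g2 [[US U12] [g1A g1S g1D] [g2A g2S g2D]]]]]] :
    exists (U1 U2 : {set C}) (g1 : G1 -> C) (g2 : G2 -> C), [/\
      S = U1 :|: U2 /\ [disjoint U1 & U2],
      [/\ coloring G1 A1 U1 g1, U1 \subset g1 @: A1
        & forall c, dominated G1 B1 T1 f1 c ->
          dominated G1 A1 U1 g1 c \/ dominated G2 A2 U2 g2 c]
    & [/\ coloring G2 A2 U2 g2, U2 \subset g2 @: A2
        & forall c, dominated G2 B2 T2 f2 c ->
          dominated G1 A1 U1 g1 c \/ dominated G2 A2 U2 g2 c]].
  have [g1U g1P] := coloringP _ _ _ _ _ g1A.
  have [g2U g2P] := coloringP _ _ _ _ _ g2A.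
  pose g (z : G1 + G2) := match z with inl x => g1 x | inr y => g2 y end.
  have g12 x y : inl x \in A -> inr y \in A -> g1 x != g2 y.
    move=> xA yA; have /g1U xU : x \in A1 by rewrite inE.
    have /g2U yU : y \in A2 by rewrite inE.
    by apply: contraTneq xU => ->; rewrite (disjointFl U12 yU).
  exists g.
    apply/coloringP; split=> [[x|x] xA|[x|x] [y|y] xA yA /= xy].
    - by rewrite US inE g1U // inE.
    - by rewrite US inE g2U ?orbT // inE.
    - by apply: g1P => //; rewrite inE.
    - exact: g12.
    - by rewrite eq_sym g12.
    - by apply: g2P => //; rewrite inE.
  move=> c /fD fc.
  have {fc} [] : dominated G1 A1 U1 g1 c \/ dominated G2 A2 U2 g2 c.
    by case: fc => [/g1D|/g2D].
    move=> /dominatedP[x /dominatingP[xA xD] fx]; rewrite inE in xA.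
    apply/dominatedP; exists (inl x) => //; apply/dominatingP; split=> // j.
    rewrite US inE => /orP[jU|/(subsetP g2S)/imsetP[y yA ->] _]; last first.
      by exists (inr y); rewrite inE in yA.
    by move=> /(xD j jU)[y [yA xy gy]]; exists (inl y); rewrite inE in yA.
  move=> /dominatedP[x /dominatingP[xA xD] fx]; rewrite inE in xA.
  apply/dominatedP; exists (inr x) => //; apply/dominatingP; split=> // j.
  rewrite US inE => /orP[/(subsetP g1S)/imsetP[y yA ->] _|jU].
    by exists (inl y); rewrite inE in yA.
  by move=> /(xD j jU)[y [yA xy gy]]; exists (inr y); rewrite inE in yA.
have domT (G : sgraph) (X : {set G}) (T : {set C}) (k : G -> C) c :
    coloring G X T k -> dominated G X T k c -> c \in T.
  by move=> /coloringP[kT _] /dominatedP[x /dominatingP[xX _] <-]; apply: kT.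
have full (G : sgraph) (X : {set G}) (T : {set C}) (k : G -> C) :
    {in T, forall c, dominated G X T k c} -> T \subset k @: X.
  by move=> D; apply/subsetP=> c cT; have /dominated_onto/subsetP/(_ c cT) := D c cT.
have DU (U : {set C}) : U \subset S -> S = U :|: S :\: U /\ [disjoint U & S :\: U].
  move=> US; split; last first.
    by rewrite -setI_eq0; apply/eqP/setP=> c; rewrite !inE; case: (c \in U).
  by rewrite -{1}(setID S U) (setIidPr US).
(* If [T1] is too small for [A1], the first side borrows colours from the second. Quantifying over
   finite functions makes the test boolean. *)
have [/existsP[k1 k1A]|/existsPn n1] :=
    boolP [exists k : {ffun G1 -> C}, coloring G1 A1 T1 k]; last first.
  have [g|U [g1 [g2 [TU US [g1A g1D] [g2A g2S] g2D]]]] :=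
    split_palette G1 G2 C A1 A2 B2 S T1 T2 _ _ h1 f2 h2 m2 BA2 h1A h2A cardH f2B
      (subxx _) T1S ST2.
    apply/negP=> /coloringP[gT gP]; have /negP[] := n1 (finfun g).
    apply/coloringP; split=> [x xA|x y xA yA xy]; rewrite !ffunE; first exact: gT.
    exact: gP.
  have [SU U12] := DU U US; exists U, (S :\: U), g1, g2; split; split=> //.
  - exact: full.
  - by move=> c /(domT _ _ _ _ _ f1B)/(subsetP TU)/g1D; left.
  - move=> c cD; have cS := subsetP T2S c (domT _ _ _ _ _ f2B cD).
    have [/g1D|cU] := boolP (c \in U); first by left.
    by right; apply: g2D; rewrite // inE cU.
have [/existsP[k2 k2A]|/existsPn n2] :=
    boolP [exists k : {ffun G2 -> C}, coloring G2 A2 T2 k]; last first.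
  rewrite addnC in cardH.
  have [g|U [g2 [g1 [TU US [g2A g2D] [g1A g1S] g1D]]]] :=
    split_palette G2 G1 C A2 A1 B1 S T2 T1 _ _ h2 f1 h1 m1 BA1 h2A h1A cardH f1B
      (subxx _) T2S ST1.
    apply/negP=> /coloringP[gT gP]; have /negP[] := n2 (finfun g).
    apply/coloringP; split=> [x xA|x y xA yA xy]; rewrite !ffunE; first exact: gT.
    exact: gP.
  have [SU U12] := DU U US; exists (S :\: U), U, g1, g2; split; split=> //.
  - by rewrite setUC.
  - by rewrite disjoint_sym.
  - move=> c cD; have cS := subsetP T1S c (domT _ _ _ _ _ f1B cD).
    have [/g2D|cU] := boolP (c \in U); first by right.
    by left; apply: g1D; rewrite // inE cU.
  - exact: full.
  - by move=> c /(domT _ _ _ _ _ f2B)/(subsetP TU)/g2D; right.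
have [g1 [g1A g1S g1D]] := dom_monotone_onto G1 C A1 B1 T1 T1 f1 k1 (m1 C A1) BA1
  (subxx _) (subxx _) f1B k1A.
have [g2 [g2A g2S g2D]] := dom_monotone_onto G2 C A2 B2 T2 T2 f2 k2 (m2 C A2) BA2
  (subxx _) (subxx _) f2B k2A.
exists T1, T2, g1, g2; split; split=> //.
- apply/eqP; rewrite eqEsubset subUset T1S T2S /= andbT.
  apply/subsetP=> c cS; rewrite inE; case: (boolP (c \in T1)) => //= cT.
  by apply: (subsetP ST2); rewrite inE cT.
- by rewrite -setI_eq0; apply/eqP/setP=> c; rewrite !inE; apply/negP=> /andP[/T12].
- by move=> c cD; left; apply: g1D => //; apply: domT cD.
- by move=> c cD; right; apply: g2D => //; apply: domT cD.
Qed.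

(** Suppose the smaller graph has the larger b-chromatic number [t]. A b-coloring of the larger
    graph uses fewer colours, so it is also a colouring with palette ['I_t]. Trading the b-coloring
    of the smaller graph then yields one of the larger with [t] colours, a contradiction. *)
Lemma dom_monotone_b_monotonic (G : sgraph) : dom_monotone G -> b_monotonic G.
Proof.
move=> mG A B; rewrite leqNgt; apply/negP=> lt_AB.
have [/existsP[cA /andP[cAP _]] maxA] := chi_bP (induced A).
have [/existsP[cB /andP[cBP cBD]] _] := chi_bP (induced B).
set t := chi_b (induced B) in lt_AB cB cBP cBD.
pose o : 'I_t := Ordinal (leq_ltn_trans (leq0n _) lt_AB).
pose i (w : induced B) : G := val (val w).
have i_inj : injective i by move=> u w /val_inj/val_inj.
pose f x := if [pick w | i w == x] is Some w then cB w else o.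
have fE w : f (i w) = cB w.
  by rewrite /f; case: pickP => [u /eqP/i_inj->|/(_ w)/eqP].
pose h (x : G) := if insub x is Some u then widen_ord (ltnW lt_AB) (cA u) else o.
have hE (u : induced A) : h (val u) = widen_ord (ltnW lt_AB) (cA u).
  by rewrite /h valK.
have BA : i @: [set: induced B] \subset A.
  by apply/subsetP=> _ /imsetP[w _ ->]; apply: valP.
have [||g /coloringP[_ gP] gD] := mG _ A (i @: [set: induced B]) [set: 'I_t] f h BA.
- apply/coloringP; split=> [x _|x y xA yA xy]; first by rewrite inE.
  have := forallP (forallP cAP (Sub x xA)) (Sub y yA).
  rewrite /adj /= /induced_adj !SubK xy /=.
  have /= -> := hE (Sub x xA); have /= -> := hE (Sub y yA).
  by rewrite -!(inj_eq val_inj).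
- apply/coloringP; split=> [x _|_ _ /imsetP[u _ ->] /imsetP[w _ ->] uw].
    by rewrite inE.
  by have := forallP (forallP cBP u) w; rewrite !fE (_ : adj u w = true).
suff /maxA : b_colorable (induced A) t by rewrite leqNgt lt_AB.
apply/existsP; exists [ffun u => g (val u)]; apply/andP; split.
  apply/forallP=> u; apply/forallP=> w; apply/implyP=> uw; rewrite !ffunE.
  exact: gP (valP u) (valP w) uw.
apply/forallP=> j.
have /gD/dominatedP[x /dominatingP[xA xD] gx] :
    dominated G (i @: [set: induced B]) [set: 'I_t] f j.
  have /existsP[w /andP[/eqP cw /forallP wD]] := forallP cBD j.
  apply/dominatedP; exists (i w); rewrite ?fE //; apply/dominatingP.
  split=> [|k _]; first exact: imset_f.
  rewrite fE cw => kj; have /existsP[u /andP[wu /eqP cu]] := implyP (wD k) kj.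
  by exists (i u); split; rewrite ?fE ?imset_f.
apply/existsP; exists (Sub x xA); rewrite ffunE /= gx eqxx /=.
apply/forallP=> k; apply/implyP=> kj.
have [|y [yA xy gy]] := xD k (in_setT k); first by rewrite gx.
by apply/existsP; exists (Sub y yA); rewrite ffunE /= gy eqxx andbT.
Qed.

(** * Forests *)

Definition joined (G : sgraph) (B : {set G}) : rel G :=
  connect [rel x y | [&& adj x y, x \in B & y \in B]].

Lemma joined_sym (G : sgraph) (B : {set G}) : symmetric (joined G B).
Proof.
apply: sym_connect_sym => x y /=; rewrite adj_sym.
by congr (_ && _); rewrite andbC.
Qed.

(** Otherwise a simple path inside [B] from [u] to [w], closed up through [v], would be a cycle with
    at least three vertices. *)
Lemma acyclic_nbr_uniq (G : sgraph) (B : {set G}) v u w :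
  acyclic G -> v \notin B -> u \in B -> adj v u -> adj v w ->
  joined G B u w -> u = w.
Proof.
move=> aG vB uB vu vw /connectP[p pP wE]; move: vw; rewrite {w}wE.
case/shortenP: pP => q qP q_uniq _ vw.
case: q => // z q in qP q_uniq vw *.
have qB : {subset z :: q <= B}.
  elim: (z :: q) u {uB vu q_uniq vw} qP => //= a s IHs b.
  case/andP=> /and3P[_ _ aB] /IHs sB c; rewrite inE => /predU1P[->//|].
  exact: sB.
suff : size [:: v, u, z & q] <= 2 by [].
apply: aG; apply/andP; split.
  rewrite /= rcons_path vu /=.
  have qadj : path (@adj G) u (z :: q).
    by apply: sub_path qP => a b /and3P[].
  by move: qadj => /= /andP[-> ->]; rewrite adj_sym.
rewrite cons_uniq q_uniq andbT; apply/negP; rewrite inE => /predU1P[vE|/qB].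
  by rewrite vE uB in vB.
by rewrite (negbTE vB).
Qed.

(* Give v the colour c, and in the component of each neighbour u of v coloured c
   swap c with t u; a component contains only one neighbour of v. *)
Lemma acyclic_recolor (G : sgraph) (C : finType) (B : {set G}) (S : {set C})
    v c (f t : G -> C) :
  acyclic G -> v \notin B -> coloring G B S f -> c \in S ->
  {in B, forall u, adj v u -> f u = c -> t u \in S /\ t u != c} ->
  exists g, [/\ coloring G (v |: B) S g, g v = c,
    {in B, forall u, adj v u -> f u != c -> g u = f u},
    {in B, forall x, dominating G B S f x -> dominating G (v |: B) S g x}
  & {in B, forall x,
      (g x = f x /\ {in B, forall u, adj v u -> f u = c -> ~~ joined G B u x})
      \/ exists u, [/\ u \in B, adj v u, f u = c, joined G B u x
                    & {in B, forall y, joined G B u y ->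
                         g y = tperm c (t u) (f y)}]}].
Proof.
move=> aG vB /coloringP[fS fP] cS tP.
(* The neighbour of [v] coloured [c] in the component of [x], if any. It is unique and constant
   along the edges of [B], so [g] applies one transposition, or none, to a whole component. *)
pose root x := [pick u in B | [&& adj v u, f u == c & joined G B u x]].
pose g x := if x == v then c else
  if root x is Some u then tperm c (t u) (f x) else f x.
have gv : g v = c by rewrite /g eqxx.
have Bv x : x \in B -> (x == v) = false.
  by move=> xB; apply: contraNF vB => /eqP <-.
have rootP u x : u \in B -> adj v u -> f u = c -> joined G B u x ->
    root x = Some u.
  move=> uB vu fu ux; rewrite /root; case: pickP => [w|/(_ u)]; last first.
    by rewrite uB vu fu eqxx ux.
  move=> /and4P[wB vw _ wx]; congr Some.
  apply: acyclic_nbr_uniq aG vB wB vw vu _.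
  by apply: connect_trans wx _; rewrite -/(joined G B x u) joined_sym.
have root_adj x y : x \in B -> y \in B -> adj x y -> root x = root y.
  move=> xB yB xy; apply: eq_pick => u; congr [&& _, _, _ & _].
  have jxy : joined G B x y by apply: connect1; rewrite /= xy xB yB.
  by apply/idP/idP => ux; apply: connect_trans ux _;
    rewrite // -/(joined G B y x) joined_sym.
have piS x k : k \in S -> (if root x is Some u then tperm c (t u) k else k) \in S.
  rewrite /root; case: pickP => // u /and4P[uB vu /eqP fu _] kS.
  by case: tpermP => //; have [] := tP u uB vu fu.
exists g; split=> //.
- apply/coloringP; split=> [x|].
    rewrite !inE => /predU1P[->|xB]; first by rewrite gv.
    by rewrite /g Bv // piS ?fS.
  have vg x : x \in B -> adj v x -> g x != c.
    move=> xB vx; rewrite /g Bv //; have [fx|fx] := eqVneq (f x) c.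
      rewrite (rootP x x xB vx fx (connect0 _ x)) fx tpermL.
      by have [] := tP x xB vx fx.
    rewrite /root; case: pickP => // u /and4P[uB vu /eqP fu ux].
    have ux_eq := acyclic_nbr_uniq G B v u x aG vB uB vu vx ux.
    by rewrite -ux_eq fu eqxx in fx.
  move=> x y; rewrite !inE => /predU1P[->|xB] /predU1P[->|yB].
  + by rewrite adj_irr.
  + by rewrite gv eq_sym; apply: vg.
  + by rewrite gv adj_sym; apply: vg.
  move=> xy; rewrite /g !Bv // (root_adj x y xB yB xy).
  by case: (root y) => [u|]; rewrite ?(inj_eq perm_inj) fP.
- move=> u uB vu fu; rewrite /g Bv // /root; case: pickP => // w.
  move=> /and4P[wB vw /eqP fw wu].
  have wu_eq := acyclic_nbr_uniq G B v w u aG vB wB vw vu wu.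
  by rewrite -wu_eq fw eqxx in fu.
- move=> x xB /dominatingP[_ xD]; apply/dominatingP; split; first by rewrite inE xB orbT.
  move=> j jS jx.
  have [] := xD (if root x is Some u then tperm c (t u) j else j) (piS x j jS).
    move: jx; rewrite /g Bv //; case: (root x) => [u|//].
    by apply: contraNneq => <-; rewrite tpermK.
  move=> y [yB xy fy]; exists y; rewrite inE yB orbT; split=> //.
  rewrite /g Bv // -(root_adj x y xB yB xy) fy.
  by case: (root x) => [u|//]; rewrite tpermK.
- move=> x xB; case rx: (root x) => [u|]; [right|left].
    move: rx; rewrite {1}/root; case: pickP => // w /and4P[uB vu /eqP fu ux] [E].
    subst w; exists u; split=> // y yB uy.
    by rewrite /g Bv // (rootP u y uB vu fu uy).
  split; first by rewrite /g Bv // rx.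
  by move=> u uB vu fu; apply/negP=> ux; rewrite (rootP u x) in rx.
Qed.

(** Vertices are added one at a time with the palette [bool]: the new vertex gets [true], and swaps
    turn its neighbours coloured [true] to [false]. *)
Lemma acyclic_bipartite (G : sgraph) :
  acyclic G -> exists s : G -> bool, forall x y, adj x y -> s x != s y.
Proof.
move=> aG; suff [s /coloringP[_ sP]] : exists s, coloring G [set: G] [set: bool] s.
  by exists s => x y; apply: sP; rewrite inE.
have [n] := ubnP #|[set: G]|; move: [set: G] => A.
elim: n A => // n IHn A; rewrite ltnS => le_n.
have [->|[v vA]] := set_0Vmem A.
  by exists xpredT; apply/coloringP; split=> x; rewrite inE.
have [|s sP] := IHn (A :\ v); first by rewrite (cardsD1 v A) vA in le_n.
have [||||g []] :=
  acyclic_recolor G bool (A :\ v) [set: bool] v true s (fun _ => false) aG.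
- by rewrite !inE eqxx.
- exact: sP.
- by rewrite inE.
- by move=> u _ _ _; rewrite inE.
by rewrite setD1K // => gP _ _ _ _; exists g.
Qed.

(** With two colours, a dominating vertex has a neighbour of the other colour; [h] gives the ends of
    this edge both colours, so both dominate under [h]. With one colour every vertex dominates. The
    forest argument can thus assume a third colour. *)
Lemma dominated_small_palette (G : sgraph) (C : finType) (A B : {set G})
    (S : {set C}) (f h : G -> C) :
  #|S| <= 2 -> B \subset A -> coloring G A S h -> coloring G B S f ->
  subpred (dominated G B S f) (dominated G A S h).
Proof.
move=> S2 /subsetP BA /coloringP[hS hP] /coloringP[fS _] c0 /dominatedP[x].
case/dominatingP=> xB xD fx.
have c0S : c0 \in S by rewrite -fx fS.
have xA := BA x xB; have hxS := hS x xA.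
have [S1|[j]] := set_0Vmem (S :\ c0); last first.
  rewrite !inE => /andP[jc jS].
  have [|y [yB xy fy]] := xD j jS; first by rewrite fx.
  have yA := BA y yB; have hyS := hS y yA; have hxy := hP x y xA yA xy.
  have SE k : k \in S -> k = h x \/ k = h y.
    move=> kS; apply/pred2P; apply: contraLR S2 => /=; rewrite negb_or => /andP[kx ky].
    rewrite -ltnNge; apply: leq_trans (_ : #|[set k; h x; h y]| <= _).
      by rewrite -setUA cardsU1 cards2 !inE negb_or kx ky hxy.
    by apply/subset_leq_card/subsetP=> i; rewrite !inE => /orP[/pred2P[]|/eqP]->.
  apply/dominatedP; case: (SE c0 c0S) => ->; [exists x|exists y] => //.
    by apply/dominatingP; split=> // k /SE[]-> => [/eqP//|_]; exists y.
  by apply/dominatingP; split=> // k /SE[]-> => [_|/eqP//]; exists x; rewrite adj_sym.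
have SE k : k \in S -> k = c0.
  move=> kS; apply/eqP; apply: contraT => kc.
  by have := in_set0 k; rewrite -S1 !inE kc kS.
apply/dominatedP; exists x; last by rewrite [h x]SE.
by apply/dominatingP; split=> // k /SE-> /eqP[]; rewrite [h x]SE.
Qed.

Lemma acyclic_dom_monotone_add (G : sgraph) (C : finType) (B : {set G})
    (S : {set C}) v (f h : G -> C) :
  acyclic G -> v \notin B -> coloring G (v |: B) S h -> coloring G B S f ->
  exists2 g, coloring G (v |: B) S g
    & subpred (dominated G B S f) (dominated G (v |: B) S g).
Proof.
move=> aG vB hA fB; have [S2|S3] := leqP #|S| 2.
  by exists h => //; apply: dominated_small_palette => //; apply: subsetUr.
have [fS fP] := coloringP _ _ _ _ _ fB.
(* If a colour is missing around [v], then [v] takes it and nothing else changes. In the other case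
   [v] sees every colour of [S]. *)
have [/existsP[c /andP[cS cN]]|/existsPn full] :=
    boolP [exists c, (c \in S) && [forall u in B, adj v u ==> (f u != c)]].
  pose g x := if x == v then c else f x.
  have gB x : x \in B -> g x = f x.
    by rewrite /g; case: eqP => // ->; rewrite (negbTE vB).
  have gv : g v = c by rewrite /g eqxx.
  have cNP u : u \in B -> adj v u -> f u != c.
    by move=> uB vu; apply: implyP (forall_inP cN u uB) vu.
  exists g.
    apply/coloringP; split=> [x|x y]; rewrite !inE.
      by case/predU1P=> [->|xB]; rewrite ?gv // gB ?fS.
    case/predU1P=> [->|xB]; case/predU1P=> [->|yB]; rewrite ?gv ?gB ?adj_irr //.
    - by move=> vy; rewrite eq_sym cNP.
    - by rewrite adj_sym; apply: cNP.
    - exact: fP.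
  move=> d /dominatedP[x /dominatingP[xB xD] fx].
  apply/dominatedP; exists x; rewrite ?gB //.
  apply/dominatingP; split; first by rewrite inE xB orbT.
  move=> j jS; rewrite gB // => jx; have [y [yB xy fy]] := xD j jS jx.
  by exists y; rewrite inE yB orbT gB.
have nbr c : c \in S -> exists u, [/\ u \in B, adj v u & f u = c].
  move=> cS; have := full c; rewrite cS /= => /forall_inPn[u uB].
  by rewrite negb_imply negbK => /andP[vu /eqP fu]; exists u.
(* The swap of c with c' in the component of u costs no dominated colour when
   good c u c' holds, since v will dominate c. *)
pose rep c := [pick x | dominating G B S f x && (f x == c)].
pose has_rep c u := if rep c is Some x then joined G B u x else false.
pose good c u c' := [&& c' \in S, c' != c & has_rep c' u ==> has_rep c u].
(* If c1 admits no good swap at u1, and c2 none at u2, then for a third colour c3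
   the representative rep c3 lies in both components, so u1 = u2. *)
have [c cS cG] : exists2 c, c \in S & {in B, forall u, adj v u -> f u = c ->
    exists c', good c u c'}.
  have /card_gt2P[c1 [c2 [c3 [[c1S c2S c3S] [c12 c23 c31]]]]] := S3.
  have [/existsP[u1 /and4P[u1B vu1 /eqP fu1 /existsPn n1]]|/existsPn n1] := boolP
      [exists u, [&& u \in B, adj v u, f u == c1 & ~~ [exists c', good c1 u c']]];
    last first.
    exists c1 => // u uB vu fu; apply/existsP; have := n1 u.
    by rewrite uB vu fu eqxx negbK.
  exists c2 => // u2 u2B vu2 fu2; apply/existsP; apply: contraT => /existsPn n2.
  have h3 k w : ~~ good k w c3 -> c3 != k -> has_rep c3 w.
    by rewrite /good c3S /= negb_and negb_imply => /orP[/negbTE->|/andP[]].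
  have := h3 _ _ (n1 c3) c31; have := h3 _ _ (n2 c3).
  rewrite eq_sym c23 => /(_ isT); rewrite /has_rep.
  case: (rep c3) => // x u2x u1x.
  have u12 : u1 = u2.
    apply: acyclic_nbr_uniq aG vB u1B vu1 vu2 _.
    by apply: connect_trans u1x _; rewrite -/(joined G B x u2) joined_sym.
  by rewrite -fu1 -fu2 u12 eqxx in c12.
pose t u := odflt c [pick c' | good c u c'].
have tP : {in B, forall u, adj v u -> f u = c -> good c u (t u)}.
  move=> u uB vu fu; rewrite /t; case: pickP => //= nc.
  by have [c'] := cG u uB vu fu; rewrite nc.
have [|g [gA gv gN gD gE]] := acyclic_recolor G C B S v c f t aG vB fB cS.
  by move=> u uB vu fu; have /and3P[] := tP u uB vu fu.
exists g => // d dD.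
have [x rd] : exists x, rep d = Some x.
  rewrite /rep; case: pickP => [x _|nx]; first by exists x.
  by have /existsP[x] := dD; rewrite nx.
have repP k y : rep k = Some y -> [/\ y \in B, dominating G B S f y & f y = k].
  rewrite /rep; case: pickP => // z /andP[zD /eqP fz] [<-]; split=> //.
  by case/dominatingP: zD.
have [xB xD fx] := repP d x rd; apply/dominatedP.
have [->|dc] := eqVneq d c.
  exists v => //; apply/dominatingP; split; first by rewrite !inE eqxx.
  move=> j jS; rewrite gv => jc; have [u [uB vu fu]] := nbr j jS.
  by exists u; rewrite inE uB orbT gN ?fu.
have [[gx _]|[u [uB vu fu ux gu]]] := gE x xB.
  by exists x; rewrite ?gx //; apply: gD.
have [td|td] := eqVneq (t u) d; last first.
  by exists x; [apply: gD | rewrite gu // fx tpermD // eq_sym].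
(* Here the swap takes [d] away from its representative [x]; [good] puts the representative [y] of
   [c] in the same component, where it receives [d]. *)
have /and3P[_ _] := tP u uB vu fu; rewrite td /has_rep rd ux /=.
case rc : (rep c) => [y|//] uy; have [yB yD fy] := repP c y rc.
by exists y; [apply: gD | rewrite gu // fy td tpermL].
Qed.

(** Induction on [#|A|], removing a vertex of [A] outside [B]; [h] keeps the intermediate sets
    colourable. The step may use all sets up to the size of [B], which the co-tree case needs for a
    subset of [B]. *)
Lemma dom_monotone_add (G : sgraph) :
  (forall (C : finType) (B : {set G}) (S : {set C}) (v : G) (f h : G -> C),
     (forall A : {set G}, #|A| <= #|B| -> dom_monotone_at G C A) ->
     v \notin B -> coloring G (v |: B) S h -> coloring G B S f ->
     exists2 g, coloring G (v |: B) S g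
       & subpred (dominated G B S f) (dominated G (v |: B) S g)) ->
  dom_monotone G.
Proof.
move=> step C A; have [n] := ubnP #|A|; elim: n => // n IHn in A *.
rewrite ltnS => le_n B S f h BA hA fB.
have [AB|/subsetPn[v vA vB]] := boolP (A \subset B).
  have E : A = B by apply/eqP; rewrite eqEsubset AB.
  by exists f; rewrite // E.
have AvA := subD1set A v.
have ltA : #|A :\ v| < n by rewrite (cardsD1 v A) vA in le_n.
have [|g gA gD] := IHn (A :\ v) ltA B S f h _ (coloring_sub _ _ _ _ _ _ AvA hA) fB.
  by rewrite subsetD1 BA vB.
have [|||g' g'A g'D] := step C (A :\ v) S v g h _ _ _ gA.
- by move=> A' leA'; apply: IHn; apply: leq_ltn_trans leA' ltA.
- by rewrite !inE eqxx.
- by rewrite setD1K.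
exists g'; first by rewrite -(setD1K vA).
by move=> c /gD/g'D; rewrite setD1K.
Qed.

Lemma acyclic_dom_monotone (G : sgraph) : acyclic G -> dom_monotone G.
Proof.
move=> aG; apply: dom_monotone_add => C B S v f h _.
exact: acyclic_dom_monotone_add.
Qed.

(** * Complements of bipartite graphs *)

Section CoBipartite.
Variables (G : sgraph) (s : G -> bool) (C : finType).
Hypothesis side_adj : forall x y : G, x != y -> s x = s y -> adj x y.
Implicit Types (A B : {set G}) (S : {set C}) (f g h : G -> C).

(** Both sides are cliques, so a colour class has at most two vertices, one per side. Classes of
    size two form a matching in the complement; lone vertices are the unmatched ones. *)
Definition lone B f u := [forall y in B, (f y == f u) ==> (y == u)].

(* An alternating two-edge step in the complement: w ~ a, and b is the mate of a
   (the other vertex of its colour class). *)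
Definition hop B f w b :=
  [exists a in B, [&& compl_adj w a, b \in B, b != a & f b == f a]].

Lemma compl_side x y : compl_adj x y -> s x = ~~ s y.
Proof.
case/andP=> xy; apply: contraNeq => sxy; apply: side_adj => //.
by move: sxy; case: (s x); case: (s y).
Qed.

Lemma class_side B S f x y :
  coloring G B S f -> x \in B -> y \in B -> x != y -> f x = f y ->
  s x = ~~ s y.
Proof.
move=> /coloringP[_ fP] xB yB xy fxy; apply: compl_side.
rewrite /compl_adj xy; apply/negP=> /(fP x y xB yB).
by rewrite fxy eqxx.
Qed.

(** The last step of an augmentation: [v] joins the class of [u], which has no other vertex, and all
    old vertices keep their colours. *)
Lemma lone_add B S v u f :
  v \notin B -> coloring G B S f -> u \in B -> lone B f u -> compl_adj v u ->
  exists2 g, coloring G (v |: B) S g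
    & subpred (dominated G B S f) (dominated G (v |: B) S g).
Proof.
move=> vB /coloringP[fS fP] uB /forall_inP u1 /andP[_ vu].
pose g x := if x == v then f u else f x.
have gB x : x \in B -> g x = f x.
  by rewrite /g; case: eqP => // ->; rewrite (negbTE vB).
have gv : g v = f u by rewrite /g eqxx.
have vP x : x \in B -> adj v x -> f x != f u.
  by move=> xB vx; apply: contraTneq vx => /eqP/(implyP (u1 x xB))/eqP->.
exists g.
  apply/coloringP; split=> [x|x y]; rewrite !inE.
    by case/predU1P=> [->|xB]; rewrite ?gv ?gB ?fS.
  case/predU1P=> [->|xB]; case/predU1P=> [->|yB]; rewrite ?gv ?gB ?adj_irr //.
  - by move=> vy; rewrite eq_sym vP.
  - by rewrite adj_sym; apply: vP.
  - exact: fP.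
move=> d /dominatedP[x /dominatingP[xB xD] fx].
apply/dominatedP; exists x; rewrite ?gB //.
apply/dominatingP; split; first by rewrite inE xB orbT.
move=> j jS; rewrite gB // => jx; have [y [yB xy fy]] := xD j jS jx.
by exists y; rewrite inE yB orbT gB.
Qed.

Lemma hop_side B S f w b :
  coloring G B S f -> hop B f w b -> s b = s w.
Proof.
move=> fB /exists_inP[a aB /and4P[wa bB ba /eqP fba]].
by rewrite (compl_side w a wa); apply: class_side fB bB aB ba fba.
Qed.

(* The uncoloured vertex moves from v to b: v takes the place of b in the class
   of a. *)
Lemma hop_step B S v b f :
  v \notin B -> coloring G B S f -> S \subset f @: B ->
  {in B, forall u, compl_adj v u -> ~~ lone B f u} -> hop B f v b ->
  exists g, let B' := v |: (B :\ b) in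
    [/\ coloring G B' S g, S \subset g @: B',
      subpred (dominated G B S f) (dominated G B' S g),
      {in B, forall u, lone B f u -> u \in B' /\ lone B' g u}
    & forall w w', s w = s v -> w' != b -> hop B f w w' -> hop B' g w w'].
Proof.
move=> vB fB Sf nlone /exists_inP[a aB /and4P[va bB ba /eqP fba]].
have [fS fP] := coloringP _ _ _ _ _ fB.
pose B' := v |: (B :\ b); pose g x := if x == v then f a else f x.
have neqv x : x \in B -> x != v by apply: contraTneq => ->.
have gB x : x \in B -> g x = f x by move=> /neqv xv; rewrite /g (negbTE xv).
have gv : g v = f a by rewrite /g eqxx.
have B'P x : x \in B' -> x = v \/ x \in B /\ x != b.
  by rewrite !inE => /predU1P[|/andP[]]; [left|right].
have inB' x : x \in B -> x != b -> x \in B' by move=> xB xb; rewrite !inE xb xB orbT.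
have vB' : v \in B' by rewrite !inE eqxx.
have sv : s v = ~~ s a := compl_side v a va.
have sb : s b = s v by rewrite sv; apply: class_side fB bB aB ba fba.
have vP y : y \in B -> y != b -> adj v y -> f y != f a.
  move=> yB yb vy; apply/eqP=> fy; have [ya|ya] := eqVneq y a.
    by move: va; rewrite /compl_adj -ya vy andbF.
  have := class_side B S f y a fB yB aB ya fy.
  have : s y = ~~ s b by apply: class_side fB yB bB yb _; rewrite fy.
  by rewrite sb sv => -> ; case: (s a).
have gP : coloring G B' S g.
  apply/coloringP; split=> [x /B'P[->|[xB xb]]|x y].
  - by rewrite gv fS.
  - by rewrite gB // fS.
  move=> /B'P[->|[xB xb]] /B'P[->|[yB yb]]; rewrite ?gv ?gB ?adj_irr //.
  - by move=> vy; rewrite eq_sym vP.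
  - by rewrite adj_sym; apply: vP.
  - exact: fP.
have Sg : S \subset g @: B'.
  apply/subsetP=> j jS; have /imsetP[y yB ->] := subsetP Sf j jS.
  have [->|yb] := eqVneq y b; first by rewrite fba -gv imset_f.
  by rewrite -gB // imset_f // inB'.
exists g; split=> //.
- move=> c /dominatedP[x /dominatingP[xB xD] fx]; apply/dominatedP.
  have [ca|ca] := eqVneq c (f a).
    (* The old dominating vertex may have been [b], but [v] now dominates [f a]: if [v] is not
       adjacent to a vertex [y] of colour [j], then [y] is not lone and its mate lies on the side of
       [v]. *)
    exists v; last by rewrite gv.
    apply/dominatingP; split=> // j jS; rewrite gv => ja.
    have /imsetP[y yB jE] := subsetP Sf j jS.
    have yb : y != b by apply: contraNneq ja => yb; rewrite jE yb fba.
    have [vy|vy] := boolP (adj v y); first by exists y; rewrite inB' // gB.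
    have vyc : compl_adj v y by rewrite /compl_adj eq_sym neqv.
    have := nlone y yB vyc => /forall_inPn[z zB].
    rewrite negb_imply => /andP[/eqP fz zy].
    exists z; rewrite gB // inB' //; last first.
      by apply: contraNneq ja => zb; rewrite jE -fz zb fba.
    split=> //; last by rewrite fz -jE.
    apply: side_adj; first by rewrite eq_sym neqv.
    rewrite (compl_side v y vyc); symmetry.
    exact: class_side fB zB yB zy fz.
  have xb : x != b by apply: contraNneq ca => xb; rewrite -fx xb fba.
  exists x; last by rewrite gB.
  apply/dominatingP; split; first exact: inB'.
  move=> j jS; rewrite gB // => jx; have [y [yB xy fy]] := xD j jS jx.
  have [yb|yb] := eqVneq y b; last by exists y; rewrite inB' // gB.
  have ja : j = f a by rewrite -fy yb fba.
  (* If [x] saw [f a] through [b], it now sees it through [v] or [a], whichever lies on its side. *)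
  have [sxv|sxv] := eqVneq (s x) (s v).
    by exists v; split=> //; [exact: side_adj (neqv x xB) sxv | rewrite gv].
  exists a; rewrite inB' 1?eq_sym // gB //; split=> //; apply: side_adj.
    by apply: contraNneq ca => <-; rewrite fx.
  by move: sxv; rewrite sv; case: (s x); case: (s a).
- move=> u uB /forall_inP u1.
  have ua : a != u.
    apply: contraNneq ba => au; rewrite au; apply: (implyP (u1 b bB)).
    by rewrite fba au.
  have ub : u != b.
    apply: contraNneq ba => ub; rewrite eq_sym -ub.
    by apply: (implyP (u1 a aB)); rewrite ub fba.
  split; first exact: inB'.
  apply/forall_inP=> y /B'P[->|[yB yb]]; rewrite (gB u) //; last first.
    by rewrite gB //; apply: u1.
  rewrite gv; apply/implyP=> fau; have := implyP (u1 a aB) fau.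
  by rewrite (negbTE ua).
(* From the side of [v] a hop passes through a vertex of the opposite side, hence not through
   [b]. *)
- move=> w w' sw w'b /exists_inP[a' a'B /and4P[wa' w'B w'a' /eqP fw']].
  apply/exists_inP; exists a'.
    apply: inB' => //; apply/negP=> /eqP a'b; have := compl_side w a' wa'.
    by rewrite a'b sb sw; case: (s v).
  by rewrite wa' inB' // w'a' !gB // fw' eqxx.
Qed.

(** Augmentation by induction on the path: [hop_step] moves the uncoloured vertex one hop forward,
    and [lone_add] colours it once it has a lone non-neighbour. Distinctness of the path vertices
    keeps the remaining hops valid. *)
Lemma hop_path_add B S v u p f :
  v \notin B -> coloring G B S f -> S \subset f @: B ->
  path (hop B f) v p -> uniq (v :: p) ->
  u \in B -> lone B f u -> compl_adj (last v p) u ->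
  exists2 g, coloring G (v |: B) S g
    & subpred (dominated G B S f) (dominated G (v |: B) S g).
Proof.
elim: p B v f => [|b p IHp] B v f vB fB Sf.
  by move=> _ _ uB u1 vu; apply: lone_add u1 vu.
move=> /= /andP[vb bp] vp_uniq uB u1 pu.
have [/exists_inP[u' u'B /andP[vu' u'1]]|nlone] :=
    boolP [exists u' in B, compl_adj v u' && lone B f u'].
  exact: lone_add u'1 vu'.
have [|g [gP Sg gD g1 ghop]] := hop_step B S v b f vB fB Sf _ vb.
  move=> u' u'B vu'; apply: contra nlone => u'1.
  by apply/exists_inP; exists u' => //; rewrite vu'.
have [a _ /and4P[_ bB _ _]] := exists_inP vb.
have AE : b |: (v |: (B :\ b)) = v |: B by rewrite setUCA setD1K.
have [uB' u1'] := g1 u uB u1.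
have ghop_path q w : s w = s v -> b \notin q -> path (hop B f) w q ->
    path (hop (v |: (B :\ b)) g) w q.
  elim: q w => //= z q IHq w sw; rewrite inE negb_or => /andP[bz bq].
  move=> /andP[wz zq]; rewrite ghop 1?eq_sym // IHq //.
  by rewrite (hop_side B S f w z fB wz).
have [|||g' g'P g'D] := IHp (v |: (B :\ b)) b g _ gP Sg _ _ uB' u1' pu.
- by rewrite !inE eqxx orbF; apply: contraNneq vB => <-.
- apply: ghop_path bp; first exact: hop_side fB vb.
  by move: vp_uniq => /= /and3P[].
- by move: vp_uniq => /andP[].
by rewrite AE in g'P g'D; exists g' => // c /gD/g'D.
Qed.

(** Without an augmenting path, the reachable set [R] is a clique on the side of [v], completely
    joined to the set [Z] of vertices whose class avoids [R]. As in a join, [R] gains one colour for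
    [v] and [Z] is recoloured without it. *)
Lemma cobipartite_dom_monotone_add B S v f h :
  (forall A, #|A| <= #|B| -> dom_monotone_at G C A) ->
  v \notin B -> coloring G (v |: B) S h -> coloring G B S f ->
  exists2 g, coloring G (v |: B) S g
    & subpred (dominated G B S f) (dominated G (v |: B) S g).
Proof.
move=> IH vB hA fB.
have [/existsP[c0 /dominated_onto Sf]|/existsPn nD] :=
    boolP [exists c, dominated G B S f c]; last first.
  by exists h => // c; rewrite /= (negbTE (nD c)).
have [fS fP] := coloringP _ _ _ _ _ fB.
have [hS hP] := coloringP _ _ _ _ _ hA.
pose R := [set w | connect (hop B f) v w].
have [/existsP[w /existsP[u /and4P[]]]|/existsPn nlone] :=
    boolP [exists w, exists u, [&& w \in R, u \in B, compl_adj w u & lone B f u]].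
  rewrite inE => /connectP[p0 p0P ->]; case/shortenP: p0P => p pP p_uniq _ uB pu u1.
  exact: hop_path_add vB fB Sf pP p_uniq uB u1 pu.
have vR : v \in R by rewrite inE connect0.
have hopR w b : w \in R -> hop B f w b -> b \in R.
  by rewrite !inE => vw /connect1; apply: connect_trans.
have hop_last x p : path (hop B f) x p ->
    s (last x p) = s x /\ last x p \in x |: B.
  elim: p x => [|b p IHp] x /=; first by rewrite !inE eqxx.
  move=> /andP[xb /IHp[-> bp]]; split; first exact: hop_side fB xb.
  have [a _ /and4P[_ bB _ _]] := exists_inP xb.
  by move: bp; rewrite !inE => /predU1P[->|->]; rewrite ?bB ?orbT.
have RsB w : w \in R -> s w = s v /\ w \in v |: B.
  by rewrite inE => /connectP[p /hop_last + ->].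
have Radj w w' : w \in R -> w' \in R -> w != w' -> adj w w'.
  by move=> /RsB[sw _] /RsB[sw' _] ww'; apply: side_adj; rewrite // sw sw'.
have RB w : w \in R -> w != v -> w \in B.
  by move=> /RsB[_]; rewrite !inE => /orP[->|->].
pose T := f @: (R :\ v); pose Z := [set z in B | f z \in S :\: T].
have ZB z : z \in Z -> z \in B by rewrite inE => /andP[].
have ZT z : z \in Z -> f z \notin T by rewrite !inE => /and3P[].
have vZ : v \notin Z by apply: contra vB; apply: ZB.
have neqv x : x \in B -> x != v by apply: contraTneq => ->.
(* R is closed under hops and has no lone neighbours, so in the complement it has
   no edges to Z. *)
have RZ w z : w \in R -> z \in Z -> adj w z.
  move=> wR zZ; have zB := ZB z zZ; apply: contraT => wz.
  have wzc : compl_adj w z.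
    rewrite /compl_adj wz andbT; apply: contraNneq (ZT z zZ) => wE.
    by apply: imset_f; rewrite !inE neqv //= -wE -inE.
  have /existsPn/(_ z) := nlone w; rewrite wR zB wzc /= => /forall_inPn[b bB].
  rewrite negb_imply => /andP[fb bz]; have bR : b \in R.
    apply: hopR wR _; apply/exists_inP; exists z => //.
    by rewrite wzc bB bz fb.
  have := ZT z zZ; rewrite -(eqP fb) imset_f // 2!inE neqv //=.
have Tcard : #|T| = #|R|.-1.
  rewrite card_in_imset ?(cardsD1 v R) ?vR // => x y.
  rewrite !(inE, in_setD1) => /andP[xv xR] /andP[yv yR] fxy.
  apply/eqP; apply: contraT => xy.
  have xy_adj : adj x y by apply: Radj => //; rewrite inE.
  by have := fP x y (RB x _ xv) (RB y _ yv) xy_adj; rewrite !inE fxy eqxx => /(_ xR yR).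
have TS : T \subset S.
  apply/subsetP=> _ /imsetP[x + ->]; rewrite in_setD1 => /andP[xv xR].
  by apply: fS; apply: RB.
have hRcard : #|h @: R| = #|R|.
  rewrite card_in_imset // => x y xR yR hxy; apply/eqP; apply: contraT => xy.
  have := hP x y (RsB x xR).2 (RsB y yR).2 (Radj x y xR yR xy).
  by rewrite hxy eqxx.
have hRS : h @: R \subset S.
  by apply/subsetP=> _ /imsetP[x /RsB[_ xA] ->]; apply: hS.
have R0 : 0 < #|R| by rewrite (cardsD1 v R) vR.
(* [h] needs [#|R|] colours on the clique [R], one more than [T] has, so a colour is left for
   [v]. *)
have TltS : #|T| < #|S|.
  by rewrite Tcard prednK // -hRcard subset_leq_card.
have [i] : exists i, i \in S :\: T.
  by apply/card_gt0P; rewrite cardsD (setIidPr TS) subn_gt0.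
rewrite inE => /andP[iT iS]; pose P := (S :\: T) :\ i.
have Pcard : #|S :\: (h @: R)| <= #|P|.
  have : #|S :\: T| = #|P|.+1 by rewrite (cardsD1 i (S :\: T)) !inE iT iS.
  rewrite (cardsD S T) (cardsD S (h @: R)) (setIidPr TS) (setIidPr hRS) hRcard Tcard.
  by case: #|R| R0 => // r _ /= e; rewrite subnS e.
(* Since [Z] is completely joined to [R], [h] leaves at most [#|S| - #|R|] colours for [Z], no more
   than [P] has. *)
have hZ : coloring G Z (S :\: h @: R) h.
  apply/coloringP; split=> [z zZ|x y /ZB xB /ZB yB]; last first.
    by apply: hP; rewrite inE ?xB ?yB orbT.
  have zA : z \in v |: B by rewrite inE (ZB z zZ) orbT.
  rewrite inE hS // andbT; apply/negP=> /imsetP[w wR hz].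
  by have := hP w z (RsB w wR).2 zA (RZ w z wR zZ); rewrite hz eqxx.
have [k kZ] := coloring_card G C Z _ P h hZ Pcard.
have fZ : coloring G Z (S :\: T) f := coloring_filter G C B S (S :\: T) f fB.
have fZS : S :\: T \subset f @: Z.
  apply/subsetP=> c cST; have cS : c \in S by move: cST; rewrite inE => /andP[].
  have /imsetP[x xB cE] := subsetP Sf c cS.
  by rewrite cE imset_f // inE xB -cE.
have ZleB : #|Z| <= #|B| by apply/subset_leq_card/subsetP.
(* [Z] plays both roles here: only the palette shrinks, from [S :\: T] to [P]. *)
have [g [gZ Pg gD]] := dom_monotone_onto G C Z Z (S :\: T) P f k (IH Z ZleB)
  (subxx _) (subD1set _ _) fZS fZ kZ.
have [gP1 gP2] := coloringP _ _ _ _ _ gZ.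
(* The vertices of [B] outside [Z] keep their colours, all of which lie in [T]. *)
pose g' x := if x == v then i else if x \in Z then g x else f x.
have g'v : g' v = i by rewrite /g' eqxx.
have g'Z x : x \in Z -> g' x = g x.
  by move=> xZ; rewrite /g' (negbTE (neqv x (ZB x xZ))) xZ.
have g'B x : x \in B -> x \notin Z -> g' x = f x.
  by move=> xB xZ; rewrite /g' (negbTE (neqv x xB)) (negbTE xZ).
have BT x : x \in B -> x \notin Z -> f x \in T.
  by move=> xB; rewrite !inE xB fS // andbT /= negbK.
have PP c : c \in P -> [/\ c \in S, c \notin T & c != i].
  by rewrite !inE => /and3P[].
have AP x : x \in v |: B ->
    [\/ x = v, x \in Z | x \in B /\ x \notin Z].
  rewrite in_setU1 => /predU1P[|xB]; first by constructor 1.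
  by have [xZ|xZ] := boolP (x \in Z); [constructor 2|constructor 3].
have ZA x : x \in Z -> x \in v |: B by move=> /ZB xB; rewrite inE xB orbT.
have RT j : j \in T -> exists2 w, w \in R & g' w = j.
  move=> jT; have /imsetP[w] := jT; rewrite in_setD1 => /andP[wv wR] jE.
  exists w => //; rewrite jE; apply: g'B; first exact: RB.
  by apply/negP=> /ZT; rewrite -jE jT.
(* The colours of [T] and [i] occur on the clique [R], those of [P] on [Z]; a vertex of [R] sees all
   of both sets except itself. *)
have seeR r j : r \in R -> j \in S -> j != g' r ->
    exists y, [/\ y \in v |: B, adj r y & g' y = j].
  move=> rR jS jr; have [ji|ji] := eqVneq j i.
    exists v; split; rewrite ?ji ?inE ?eqxx //; apply: Radj => //.
    by apply: contraNneq jr => ->; rewrite g'v ji.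
  have [jT|jT] := boolP (j \in T).
    have [w wR gw] := RT j jT; exists w; split=> //; first exact: (RsB w wR).2.
    by apply: Radj => //; apply: contraNneq jr => ->; rewrite gw.
  have /imsetP[y yZ ->] : j \in g @: Z by apply: (subsetP Pg); rewrite !inE ji jT jS.
  by exists y; rewrite ZA // g'Z // RZ.
have domR r : r \in R -> dominated G (v |: B) S g' (g' r).
  move=> rR; apply/dominatedP; exists r => //; apply/dominatingP.
  by split; [exact: (RsB r rR).2 | move=> j; apply: seeR].
exists g'.
  have gvP x : x \in B -> g' x != i.
    move=> xB; have [xZ|xZ] := boolP (x \in Z).
      by rewrite g'Z //; have [] := PP _ (gP1 x xZ).
    by rewrite g'B //; apply: contraNneq iT => <-; apply: BT.
  have gZP x y : x \in Z -> y \in B -> y \notin Z -> g' x != g' y.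
    move=> xZ yB yZ; rewrite g'Z // g'B //.
    have [_ xT _] := PP _ (gP1 x xZ).
    by apply: contraNneq xT => ->; apply: BT.
  apply/coloringP; split=> [x /AP[->|xZ|[xB xZ]]|x y].
  - by rewrite g'v.
  - by rewrite g'Z //; have [] := PP _ (gP1 x xZ).
  - by rewrite g'B // fS.
  case/AP=> [->|xZ|[xB xZ]] /AP[->|yZ|[yB yZ]] xy.
  - by rewrite adj_irr in xy.
  - by rewrite g'v eq_sym gvP // ZB.
  - by rewrite g'v eq_sym gvP.
  - by rewrite g'v gvP // ZB.
  - by rewrite !g'Z // gP2.
  - exact: gZP.
  - by rewrite g'v gvP.
  - by rewrite eq_sym gZP.
  - by rewrite !g'B // fP.
move=> c fc; have cS : c \in S.
  by have /dominatedP[x /dominatingP[xB _] <-] := fc; apply: fS.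
have [->|ci] := eqVneq c i; first by rewrite -g'v domR.
have [cT|cT] := boolP (c \in T).
  by have [w wR <-] := RT c cT; apply: domR.
have cP : c \in P by rewrite !inE ci cT cS.
have cST : c \in S :\: T by rewrite inE cT cS.
have := gD c cP (dominated_filter G C B S _ f c (subsetDl _ _) cST fc).
case/dominatedP=> x /dominatingP[xZ xD] gx.
apply/dominatedP; exists x; rewrite ?g'Z //; apply/dominatingP.
split=> [|j jS]; first exact: ZA.
rewrite g'Z // => jx.
(* Colours outside [P] occur on [R], which every vertex of [Z] sees. *)
have [[r rR gr]|jP] : (exists2 r, r \in R & g' r = j) \/ j \in P.
  have [->|ji] := eqVneq j i; first by left; exists v.
  have [/RT|jT] := boolP (j \in T); first by left.
  by right; rewrite !inE ji jT jS.
  exists r; split; [exact: (RsB r rR).2 | rewrite adj_sym; exact: RZ | by []].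
have [y [yZ xy gy]] := xD j jP jx.
by exists y; rewrite ZA // g'Z.
Qed.
End CoBipartite.

(** * Co-trees and tree-cographs *)

Lemma cotree_dom_monotone (G : sgraph) : cotree G -> dom_monotone G.
Proof.
case=> _ _ /acyclic_bipartite[s sP]; apply: dom_monotone_add => C B S v f h.
(* The bipartition of the complement serves as [s]: distinct vertices on one side are non-adjacent
   there, hence adjacent in [G]. *)
apply: (@cobipartite_dom_monotone_add G s C) => x y xy sxy.
apply: contraT => nxy; have := sP x y; rewrite /adj /= /compl_adj xy nxy sxy eqxx.
by move=> /(_ isT).
Qed.

Lemma tree_cograph_dom_monotone (G : sgraph) : tree_cograph G -> dom_monotone G.
Proof.
elim=> {G} [G [_ _]|G|G G1 G2 _ m1 _ m2 /iso_dom_monotone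
             |G G1 G2 _ m1 _ m2 /iso_dom_monotone].
- exact: acyclic_dom_monotone.
- exact: cotree_dom_monotone.
- by apply; apply: union_dom_monotone.
- by apply; apply: join_dom_monotone.
Qed.

Theorem theorem24 (G : sgraph) (hG : tree_cograph G) : b_monotonic G.
Proof.
exact: dom_monotone_b_monotonic (tree_cograph_dom_monotone G hG).
Qed.
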